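(* Let $t=\{t_k\}_{k=1}^\infty$ and $s=\{s_k\}_{k=1}^\infty$ be non-increasing sequences of positive numbers. Let $n\in\mathbb{N}$, $1<p<\infty$, $q=p/(p-1)$, $r\in(0,1]$ and $\varepsilon\ge0$. If $\varepsilon\le t_1s_1$, then $$\mathcal{E}\left(A,W^{T,S}_{p,q},J^n_{\varepsilon,r}\right)=\mathcal{E}\left(A,W^{T,S}_{p,q},J^n_{\varepsilon,r},\Psi^*_n\right)=t_{n+1}s_{n+1}+\varepsilon\left(1-\frac{t_{n+1}s_{n+1}}{t_1s_1}\right),$$ and if $\varepsilon>t_1s_1$, then $$\mathcal{E}\left(A,W^{T,S}_{p,q},J^n_{\varepsilon,r}\right)=\mathcal{E}\left(A,W^{T,S}_{p,q},J^n_{\varepsilon,r},\Psi^*_0\right)=t_1s_1.$$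
   Context: $\ell_p$, $\ell_q$ are the usual spaces of complex sequences with norms $\|\cdot\|_p,\|\cdot\|_q$. Put $Th=\{t_kh_k\}_{k=1}^\infty$ for $h\in\ell_p$ and $Sg=\{s_kg_k\}_{k=1}^\infty$ for $g\in\ell_q$. The classes are $W^T_p=\{Th:h\in\ell_p,\|h\|_p\le1\}$, $W^S_q=\{Sg:g\in\ell_q,\|g\|_q\le1\}$ and $W^{T,S}_{p,q}=W^T_p\times W^S_q$. The operator is $A:\ell_p\times\ell_q\to\mathbb{C}$, $A(x,y)=\langle x,y\rangle=\sum_{k=1}^\infty x_ky_k$. An information mapping $J$ assigns to each $(x,y)\in\ell_p\times\ell_q$ a non-empty subset $J(x,y)\subset\mathbb{C}^n\times\mathbb{C}^n$. A method of recovery is an arbitrary mapping $\Psi:\mathbb{C}^n\times\mathbb{C}^n\to\mathbb{C}$. Its error is $\mathcal{E}(A,W,J,\Psi)=\sup_{(x,y)\in W}\sup_{(a,b)\in J(x,y)}|\langle x,y\rangle-\Psi(a,b)|$, and $\mathcal{E}(A,W,J)=\inf_\Psi\mathcal{E}(A,W,J,\Psi)$ over all methods $\Psi$. Here $J^n_{\varepsilon,r}(x,y)=\{(a,b)\in\mathbb{C}^n\times\mathbb{C}^n:(\sum_{k=1}^n|x_ky_k-a_kb_k|^r)^{1/r}\le\varepsilon\}$. The methods are $$\Psi^*_n(a,b)=\sum_{k=1}^na_kb_k\left(1-\frac{t_{n+1}s_{n+1}}{t_ks_k}\right),\qquad \Psi^*_0(a,b)=0.$$ *)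

(* Defs.v *)
(* Complex numbers are R[i] over an arbitrary R : realType.
   Sequences are indexed from 0: the informal t_k, x_k, ... (k >= 1) is t k.-1,
   x k.-1, so that t_1 is t 0 and t_{n+1} is t n. *)
From HB Require Import structures.
From mathcomp Require Export all_boot all_order all_algebra.
From mathcomp Require Export all_classical all_reals all_analysis.
From mathcomp Require Export complex.
Export Order.TTheory GRing.Theory Num.Theory numFieldNormedType.Exports.

Set Implicit Arguments.
Unset Strict Implicit.
Unset Printing Implicit Defensive.

Global Open Scope classical_set_scope.
Global Open Scope complex_scope.
Global Open Scope ring_scope.

(* [Normc.normc : R[i] -> R] is the complex modulus with values in R, whereas
   the generic norm [`|z|] lives in R[i]. *)
Definition cmod (R : realType) (z : R[i]) : R := ComplexField.Normc.normc z.

Section OptimalRecovery.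
Context (R : realType) (X Y : Type).
Implicit Types (A : X -> R[i]) (W : set X) (J : X -> set Y) (Psi : Y -> R[i]).

Definition recovery_error A W J Psi : \bar R :=
  ereal_sup [set ereal_sup [set (cmod (A x - Psi y))%:E | y in J x] | x in W].

Definition optimal_error A W J : \bar R :=
  ereal_inf [set recovery_error A W J Psi | Psi in [set: Y -> R[i]]].

End OptimalRecovery.

Section Sequences.
Context (R : realType).
Implicit Types (x y h g : nat -> R[i]) (t s : nat -> R) (p q r eps : R).

Definition lnorm p x : \bar R :=
  ('N[counting]_(p%:E) [EFin \o (fun k => cmod (x k))])%E.

Definition lspace p : set (nat -> R[i]) := [set x | (lnorm p x < +oo)%E].

Definition diag_op t h : nat -> R[i] := fun k => (t k)%:C * h k.

Definition diag_class p t : set (nat -> R[i]) :=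
  [set diag_op t h | h in [set h | lspace p h /\ (lnorm p h <= 1)%E]].

(* [R[i]^o] is R[i] with the topology given by the modulus. [limn] is the sum
   whenever the series converges, as it does on l_p x l_q for conjugate p, q;
   the value elsewhere is irrelevant. *)
Definition pairing (xy : (nat -> R[i]) * (nat -> R[i])) : R[i] :=
  limn (series ((fun k => xy.1 k * xy.2 k) : (R[i]^o)^nat)).

Definition noisy_info n eps r (xy : (nat -> R[i]) * (nat -> R[i])) :
    set ('rV[R[i]]_n * 'rV[R[i]]_n) :=
  [set ab : 'rV[R[i]]_n * 'rV[R[i]]_n | (\sum_(k < n)
      cmod (xy.1 k * xy.2 k - ab.1 ord0 k * ab.2 ord0 k) `^ r) `^ r^-1 <= eps].

Definition Psi_star t s n (ab : 'rV[R[i]]_n * 'rV[R[i]]_n) : R[i] :=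
  \sum_(k < n) ab.1 ord0 k * ab.2 ord0 k
               * (1 - (t n * s n) / (t k * s k))%:C.

(* The zero method, still defined on the information space of size n. *)
Definition Psi_zero n (ab : 'rV[R[i]]_n * 'rV[R[i]]_n) : R[i] := 0.

End Sequences.

(* Main.v *)
Require Import Defs.
From mathcomp Require Import ring lra.

(** The upper bounds come from Hoelder's inequality. If x = T h and y = S g with
    h and g in the unit balls, then x_k y_k = t_k s_k w_k, where w = h g has
    l_1 norm at most 1; hence |<x, y>| <= t_1 s_1, which is the error of the
    zero method. Writing u_k = 1 - t_{n+1} s_{n+1} / (t_k s_k), the error of
    Psi^*_n splits as
<<
      <x, y> - Psi^*_n(a, b) = sum_k min(t_{n+1} s_{n+1}, t_k s_k) w_k
                               + sum_{k <= n} (x_k y_k - a_k b_k) u_k.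
>>
    The first sum is at most t_{n+1} s_{n+1}. In the second one 0 <= u_k <= u_1
    and the l_1 norm of the noise is at most its l_r quasi-norm, because r <= 1,
    so it is at most eps u_1 ([Psi_star_error]).

    The lower bound is the usual antipodal argument: if two inputs admit the
    same data and the operator takes the values v and -v on them, no method has
    error below v ([recovery_error_ge_antipodal]). The common data are a = b = 0.
    Put mass alpha at the first coordinate and 1 - alpha at the coordinate n + 1,
    and let h and g be the 1/p-th and 1/q-th powers of this weight; they have
    norm 1, and their sign is carried by h. The value is then
    v = alpha t_1 s_1 + (1 - alpha) t_{n+1} s_{n+1}, and the zero data are
    admissible as soon as alpha t_1 s_1 <= eps, the coordinate n + 1 being
    invisible to the information. Taking alpha = min(1, eps / (t_1 s_1)) gives
    exactly the upper bound in both cases ([recovery_error_ge_two_point]).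

    The indices above start at 1, those of the code at 0. *)

Set Implicit Arguments.
Unset Strict Implicit.
Unset Printing Implicit Defensive.

(** * The complex modulus as a real number *)

Section Modulus.
Context (R : realType).
Implicit Types (z w : R[i]) (x : R).

Lemma cmodE z : `|z| = (cmod z)%:C.
Proof. by []. Qed.

Lemma cmod_ge0 z : 0 <= cmod z.
Proof. by rewrite -lecR -cmodE normr_ge0. Qed.

Lemma cmodM z w : cmod (z * w) = cmod z * cmod w.
Proof. exact: ComplexField.Normc.normcM. Qed.

Lemma cmodN z : cmod (- z) = cmod z.
Proof. exact: normcN. Qed.

Lemma cmodD z w : cmod (z + w) <= cmod z + cmod w.
Proof. exact: le_normcD. Qed.

Lemma cmod_real x : cmod x%:C = `|x|.
Proof. by rewrite /cmod /= expr0n /= addr0 sqrtr_sqr. Qed.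

Lemma cmod_sum (I : Type) (s : seq I) (P : pred I) (F : I -> R[i]) :
  cmod (\sum_(i <- s | P i) F i) <= \sum_(i <- s | P i) cmod (F i).
Proof.
elim/big_rec2: _ => [|i x z _ le_zx]; first by rewrite (cmod_real 0) normr0.
by apply: le_trans (cmodD _ _) _; rewrite lerD2l.
Qed.

Lemma ReB z w : complex.Re (z - w) = complex.Re z - complex.Re w.
Proof. by case: z w => [? ?] [? ?]. Qed.

Lemma ImB z w : complex.Im (z - w) = complex.Im z - complex.Im w.
Proof. by case: z w => [? ?] [? ?]. Qed.

Lemma Re_sum (I : Type) (s : seq I) (F : I -> R[i]) :
  complex.Re (\sum_(i <- s) F i) = \sum_(i <- s) complex.Re (F i).
Proof. by apply: (big_morph (@complex.Re R)) => // -[? ?] [? ?]. Qed.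

Lemma Im_sum (I : Type) (s : seq I) (F : I -> R[i]) :
  complex.Im (\sum_(i <- s) F i) = \sum_(i <- s) complex.Im (F i).
Proof. by apply: (big_morph (@complex.Im R)) => // -[? ?] [? ?]. Qed.

Lemma norm_Re_le z : `|complex.Re z| <= cmod z.
Proof. by rewrite -lecR -cmodE normc_ge_Re. Qed.

Lemma norm_Im_le z : `|complex.Im z| <= cmod z.
Proof. 
have -> : complex.Im z = - complex.Re (z * 'i%C) by rewrite ReiNIm opprK.
rewrite normrN (le_trans (norm_Re_le _))// cmodM.
by rewrite [X in _ * X]/cmod /= expr0n/= expr1n add0r sqrtr1 mulr1.
Qed.

Lemma cmod_le_ReIm z : cmod z <= `|complex.Re z| + `|complex.Im z|.
Proof.
rewrite [in leLHS](complexE z) (le_trans (cmodD _ _))//.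
rewrite cmodM !cmod_real [X in X * _]/cmod /=.
by rewrite expr0n/= expr1n add0r sqrtr1 mul1r.
Qed.

End Modulus.

(** * Absolutely convergent complex series *)

Section ComplexSeries.
Context (R : realType).
Implicit Types (z : nat -> R[i]) (M : R).

Lemma abs_bounded_cvg_series (u : R^nat) M :
  (forall N, \sum_(k < N) `|u k| <= M) -> cvgn (series u).
Proof.
move=> uM; apply: normed_cvg; apply: nondecreasing_is_cvgn.
  by apply: nondecreasing_series => *; exact: normr_ge0.
by exists M => _ [N _ <-] /=; rewrite seriesEord; exact: uM.
Qed.

(** The real and imaginary parts are dominated by the modulus, which reduces the
    convergence to that of two real series. *)
Lemma complex_series_cvg z M :
  (forall N, \sum_(k < N) cmod (z k) <= M) -> cvgn (series (z : (R[i]^o)^nat)).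
Proof.
move=> zM.
have part (f : R[i] -> R) : (forall w, `|f w| <= cmod w) ->
    cvgn (series (fun k => f (z k))).
  move=> f_le; apply: (@abs_bounded_cvg_series _ M) => N.
  by apply: le_trans (zM N); apply: ler_sum => k _; exact: f_le.
have /cvg_ex[/= a /cvgrPdist_lt a_lim] := part _ (@norm_Re_le R).
have /cvg_ex[/= b /cvgrPdist_lt b_lim] := part _ (@norm_Im_le R).
apply/cvg_ex; exists (a +i* b : R[i]^o); apply/cvgrPdist_lt => -[e e'].
rewrite ltcE /= => /andP[/eqP -> e_gt0].
have e2_gt0 : 0 < e / 2 by rewrite divr_gt0.
near=> N; rewrite (cmodE ((a +i* b) - \sum_(0 <= k < N) z k)) ltcR.
apply: le_lt_trans (cmod_le_ReIm _) _.
rewrite (splitr e) ReB ImB Re_sum Im_sum /= ltrD//.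
  by near: N; exact: a_lim.
by near: N; exact: b_lim.
Unshelve. all: by end_near. Qed.

(** Distance bounds on partial sums pass to the limit; the bound [M] on the
    moduli guarantees that [limn] is the sum of the series. *)
Lemma complex_series_near z (c : R[i]) (n : nat) (M B : R) :
  (forall N, \sum_(k < N) cmod (z k) <= M) ->
  (forall N, (n <= N)%N -> cmod (\sum_(k < N) z k - c) <= B) ->
  cmod (limn (series (z : (R[i]^o)^nat)) - c) <= B.
Proof.
move=> /complex_series_cvg/cvgrPdist_lt; set l := limn _ => z_lim zB.
apply/ler_addgt0Pr => e e_gt0.
have e_gt0' : 0 < e%:C by rewrite (ltcR 0).
have [N [le_nN]] : exists N, (n <= N)%N /\ cmod (l - \sum_(k < N) z k) < e.
  have [m _ zm] := z_lim _ e_gt0'; exists (maxn n m); split.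
    exact: leq_maxl.
  by move: (zm _ (leq_maxr n m)); rewrite /series /= big_mkord -ltcR.
have -> : l - c = (\sum_(k < N) z k - c) + (l - \sum_(k < N) z k) by ring.
by move=> /ltW le_e; apply: le_trans (cmodD _ _) _; rewrite lerD// zB.
Qed.

End ComplexSeries.

(** * Inequalities between sums *)

Section RealInequalities.
Context (R : realType).

(** With T the right-hand side, each [c k] is at most T, so that
    [c k = c k `^ r * c k `^ (1 - r) <= c k `^ r * T `^ (1 - r)]; summing gives
    [T `^ r * T `^ (1 - r) = T]. *)
Lemma sum_le_powR_sum (n : nat) (c : 'I_n -> R) (r : R) :
  0 < r -> r <= 1 -> (forall k, 0 <= c k) ->
  \sum_(k < n) c k <= (\sum_(k < n) c k `^ r) `^ r^-1.
Proof.
move=> r_gt0 r_le1 c_ge0; set S := \sum_(k < n) c k `^ r.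
have S_ge0 : 0 <= S by apply: sumr_ge0 => k _; exact: powR_ge0.
pose T := S `^ r^-1.
have T_ge0 : 0 <= T by exact: powR_ge0.
have TrE : T `^ r = S by rewrite -powRrM mulVf ?gt_eqF// powRr1.
have c_le k : c k <= T.
  have -> : c k = (c k `^ r) `^ r^-1 by rewrite -powRrM mulfV ?gt_eqF// powRr1.
  apply: ge0_ler_powR; rewrite ?invr_ge0 ?nnegrE ?powR_ge0 ?(ltW r_gt0)//.
  by rewrite /S (bigD1 k)//= lerDl sumr_ge0// => j _; exact: powR_ge0.
have split_powR x : 0 <= x -> x = x `^ r * x `^ (1 - r).
  move=> x_ge0; rewrite -powRD; last by rewrite addrC subrK oner_eq0.
  by rewrite addrC subrK powRr1.
rewrite -/T [leRHS]split_powR// TrE /S mulr_suml; apply: ler_sum => k _.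
rewrite [leLHS]split_powR// ler_wpM2l ?powR_ge0//.
by apply: ge0_ler_powR; rewrite ?subr_ge0 ?nnegrE.
Qed.

Lemma conjugate_inv_sum (p q : R) : 1 < p -> q = p / (p - 1) ->
  0 < q /\ p^-1 + q^-1 = 1.
Proof.
move=> p_gt1 ->; have p_gt0 : 0 < p by exact: lt_trans p_gt1.
have p1_gt0 : 0 < p - 1 by rewrite subr_gt0.
split; first by rewrite divr_gt0.
by field; rewrite !gt_eqF.
Qed.

Lemma holder_partial_sum (p q : R) (h g : nat -> R[i]) (N : nat) :
  0 < p -> 0 < q -> p^-1 + q^-1 = 1 ->
  (lnorm p h <= 1)%E -> (lnorm q g <= 1)%E ->
  \sum_(k < N) cmod (h k * g k) <= 1.
Proof.
move=> p_gt0 q_gt0 pq h_le1 g_le1.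
have mf (f : nat -> R) : measurable_fun setT f by [].
have := hoelder counting (mf (fun k => cmod (h k))) (mf (fun k => cmod (g k)))
  p_gt0 q_gt0 pq.
have := lee_pmul (Lnorm_ge0 _ _ _) (Lnorm_ge0 _ _ _) h_le1 g_le1.
rewrite mul1e => /[swap] /le_trans /[apply].
rewrite Lnorm_counting// invr1 poweRe1; last first.
  by apply: nneseries_ge0 => *; exact: poweR_ge0.
rewrite -lee_fin; apply: le_trans.
have := @nneseries_lim_ge R (fun k => (cmod (h k * g k))%:E) xpredT 0 N.
rewrite big_mkord sumEFin => /(_ _)/le_trans; apply.
  by move=> *; rewrite lee_fin cmod_ge0.
rewrite le_eqVlt; apply/orP; left; apply/eqP; apply: eq_eseriesr => k _ /=.
by rewrite powRr1// ger0_norm ?mulr_ge0 ?cmod_ge0// cmodM.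
Qed.

End RealInequalities.

(** * Optimal recovery *)

Section Recovery.
Context (R : realType) (X Y : Type).
Implicit Types (A : X -> R[i]) (W : set X) (J : X -> set Y) (Psi : Y -> R[i]).

Lemma recovery_error_ge A W J Psi x y :
  W x -> J x y -> ((cmod (A x - Psi y))%:E <= recovery_error A W J Psi)%E.
Proof.
move=> Wx Jxy.
apply: (@le_trans _ _ (ereal_sup [set (cmod (A x - Psi y))%:E | y in J x])).
  by apply: ereal_sup_ubound; exists y.
by apply: ereal_sup_ubound; exists x.
Qed.

Lemma recovery_error_le A W J Psi (B : R) :
  (forall x y, W x -> J x y -> cmod (A x - Psi y) <= B) ->
  (recovery_error A W J Psi <= B%:E)%E.
Proof.
move=> AB; apply: ge_ereal_sup => _ [x Wx <-].
by apply: ge_ereal_sup => _ [y Jxy <-]; rewrite lee_fin AB.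
Qed.

(** The triangle inequality gives
    [2 v <= cmod (A x - Psi y) + cmod (A x' - Psi y)], so one of the two errors is
    at least [v]. *)
Lemma recovery_error_ge_antipodal A W J Psi x x' y (v : R) :
  W x -> W x' -> J x y -> J x' y -> A x = v%:C -> A x' = - v%:C ->
  (v%:E <= recovery_error A W J Psi)%E.
Proof.
move=> Wx Wx' Jx Jx' Ax Ax'; have [le_v|lt_v] := leP v (cmod (A x - Psi y)).
  by apply: le_trans (recovery_error_ge A Psi Wx Jx); rewrite lee_fin.
apply: le_trans (recovery_error_ge A Psi Wx' Jx'); rewrite lee_fin.
have : cmod ((A x - Psi y) + - (A x' - Psi y)) <= _ := cmodD _ _.
have -> : (A x - Psi y) + - (A x' - Psi y) = (v + v)%:C.
  by rewrite Ax Ax' rmorphD /=; ring.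
by rewrite cmodN cmod_real => /(le_trans (ler_norm _)); lra.
Qed.

Lemma optimal_errorE A W J Psi (B : R) :
  (forall Phi, (B%:E <= recovery_error A W J Phi)%E) ->
  (recovery_error A W J Psi <= B%:E)%E ->
  optimal_error A W J = recovery_error A W J Psi /\
  recovery_error A W J Psi = B%:E.
Proof.
move=> lowB uppB.
have errE : recovery_error A W J Psi = B%:E by apply/eqP; rewrite eq_le uppB lowB.
split=> //; apply/eqP; rewrite eq_le; apply/andP; split.
  by apply: ereal_inf_lbound; exists Psi.
by rewrite errE; apply: le_ereal_inf_tmp => _ [Phi _ <-].
Qed.

End Recovery.

(** * Sequences supported on two coordinates *)

(** The two coordinates may coincide: this is what makes the case [n = 0] of
    the lower bound no exception. *)
Lemma big_two_point (V : zmodType) (f g : nat -> V) (n N : nat) : (n < N)%N ->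
  \sum_(k < N) (f k *+ (k == 0%N :> nat) + g k *+ (k == n :> nat)) = f 0%N + g n.
Proof.
have one (c : nat -> V) m : (m < N)%N ->
    \sum_(k < N) c k *+ (k == m :> nat) = c m.
  move=> m_ltN; rewrite (bigD1 (Ordinal m_ltN))//= eqxx big1 ?addr0// => k.
  by rewrite -val_eqE /= => /negbTE ->.
by move=> n_ltN; rewrite big_split /= !one// (leq_ltn_trans _ n_ltN).
Qed.

(** * Upper bounds for the two methods *)

Section UpperBound.
Context (R : realType) (t s : nat -> R).
Context (t_gt0 : forall k, 0 < t k) (s_gt0 : forall k, 0 < s k).
Context (t_nonincr : nonincreasing_seq t) (s_nonincr : nonincreasing_seq s).

Let ts_gt0 k : 0 < t k * s k.
Proof. exact: mulr_gt0. Qed.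

Let ts_nonincr j k : (j <= k)%N -> t k * s k <= t j * s j.
Proof.
by move=> le_jk; rewrite ler_pM ?(ltW (t_gt0 _)) ?(ltW (s_gt0 _))//;
  [exact: t_nonincr | exact: s_nonincr].
Qed.

Lemma class_prod_bound (p q : R) x y : 1 < p -> q = p / (p - 1) ->
  diag_class p t x -> diag_class q s y ->
  exists2 w : nat -> R[i],
    (forall k, x k * y k = (t k * s k)%:C * w k)
  & (forall N, \sum_(k < N) cmod (w k) <= 1).
Proof.
move=> p_gt1 qE [h [_ h_le1] <-] [g [_ g_le1] <-].
have [q_gt0 pq] := conjugate_inv_sum p_gt1 qE.
exists (fun k => h k * g k) => [k|N]; last first.
  exact: holder_partial_sum (lt_trans ltr01 p_gt1) q_gt0 pq h_le1 g_le1.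
by rewrite /diag_op rmorphM /=; ring.
Qed.

Lemma class_prod_abs_sum (p q : R) x y N : 1 < p -> q = p / (p - 1) ->
  diag_class p t x -> diag_class q s y ->
  \sum_(k < N) cmod (x k * y k) <= t 0%N * s 0%N.
Proof.
move=> p_gt1 qE Wx Wy.
have [w xyE w_le1] := class_prod_bound p_gt1 qE Wx Wy.
rewrite -[leRHS]mulr1; apply: le_trans (ler_wpM2l (ltW (ts_gt0 _)) (w_le1 N)).
rewrite mulr_sumr; apply: ler_sum => k _ /=.
rewrite xyE cmodM cmod_real gtr0_norm ?ts_gt0//.
by rewrite ler_wpM2r ?cmod_ge0 ?ts_nonincr.
Qed.

(** For [k < n] the method multiplies the k-th datum by [u k], leaving out the part
    [tau n * w k] of [x k * y k = tau k * w k]. The left-out parts and the unseen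
    coordinates together have weights at most [tau n] in front of [w], so they
    share one application of Hoelder's inequality. *)
Lemma Psi_star_error (p q r eps : R) n x y ab :
  1 < p -> q = p / (p - 1) -> 0 < r -> r <= 1 ->
  diag_class p t x -> diag_class q s y -> noisy_info eps r (x, y) ab ->
  cmod (pairing (x, y) - @Psi_star R t s n ab) <=
    t n * s n + eps * (1 - (t n * s n) / (t 0%N * s 0%N)).
Proof.
move=> p_gt1 qE r_gt0 r_le1 Wx Wy /= Jab.
have [w xyE w_le1] := class_prod_bound p_gt1 qE Wx Wy.
pose tau k := t k * s k; pose u k := 1 - tau n / tau k.
have u_bound (k : 'I_n) : 0 <= u k <= u 0%N.
  rewrite /u subr_ge0 ler_pdivrMr ?ts_gt0// mul1r ts_nonincr 1?ltnW//=.
  by rewrite lerD2l lerN2 ler_pM2l ?ts_gt0// lef_pV2 ?posrE ?ts_gt0// ts_nonincr.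
apply: (@complex_series_near _ _ _ n (tau 0%N)) => N.
  exact: class_prod_abs_sum p_gt1 qE Wx Wy.
move=> le_nN /=.
(* [v k] is [min (tau n) (tau k) * w k], since [tau] is nonincreasing. *)
pose v k := (if (k < n)%N then tau n else tau k)%:C * w k.
have -> : \sum_(k < N) x k * y k - Psi_star t s ab = \sum_(k < N) v k +
    \sum_(k < n) (x k * y k - ab.1 ord0 k * ab.2 ord0 k) * (u k)%:C.
  rewrite -(subnKC le_nN) !big_split_ord /= [X in _ = _ + X + _](_ : _ =
    \sum_(i < N - n) x (n + i)%N * y (n + i)%N); last first.
    by apply: eq_bigr => i _; rewrite /v ltnNge leq_addr /= -xyE.
  rewrite [RHS]addrAC -big_split /= [LHS]addrAC -sumrB; congr (_ + _).
  apply: eq_bigr => k _; rewrite /v ltn_ord xyE -/(tau k) /u.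
  have -> : (tau n)%:C = (tau k)%:C * (tau n / tau k)%:C.
    by rewrite -rmorphM /= mulrC mulfVK// gt_eqF// ts_gt0.
  by rewrite -!/(tau _) rmorphB /= rmorph1; ring.
apply: le_trans (cmodD _ _) _; rewrite lerD//.
  rewrite -[leRHS]mulr1; apply: le_trans (ler_wpM2l (ltW (ts_gt0 _)) (w_le1 N)).
  rewrite mulr_sumr; apply: le_trans (cmod_sum _ _ _) _; apply: ler_sum => k _.
  rewrite cmodM cmod_real gtr0_norm; last by case: ifP => _; exact: ts_gt0.
  rewrite ler_wpM2r ?cmod_ge0//; case: ltnP => // le_nk; exact: ts_nonincr.
have err_le : \sum_(k < n) cmod (x k * y k - ab.1 ord0 k * ab.2 ord0 k) <= eps.
  apply: le_trans Jab; apply: sum_le_powR_sum => // k; exact: cmod_ge0.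
have u0_ge0 : 0 <= u 0%N.
  by rewrite subr_ge0 ler_pdivrMr ?ts_gt0// mul1r ts_nonincr.
apply: le_trans (ler_wpM2r u0_ge0 err_le); rewrite mulr_suml.
apply: le_trans (cmod_sum _ _ _) _; apply: ler_sum => k _.
have /andP[uk_ge0 uk_le] := u_bound k.
by rewrite cmodM cmod_real ger0_norm// ler_wpM2l ?cmod_ge0.
Qed.

Lemma pairing_le (p q : R) x y : 1 < p -> q = p / (p - 1) ->
  diag_class p t x -> diag_class q s y ->
  cmod (pairing (x, y)) <= t 0%N * s 0%N.
Proof.
move=> p_gt1 qE Wx Wy.
have sum_le N := class_prod_abs_sum N p_gt1 qE Wx Wy.
rewrite -[pairing _]subr0; apply: (complex_series_near sum_le (n := 0)) => N _.
by rewrite subr0; apply: le_trans (cmod_sum _ _ _) (sum_le N).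
Qed.

End UpperBound.

(** * The lower bound *)

Section LowerBound.
Context (R : realType) (t s : nat -> R) (n : nat) (alpha : R).
Context (alpha_ge0 : 0 <= alpha) (alpha_le1 : alpha <= 1).

Let w k : R := alpha *+ (k == 0%N) + (1 - alpha) *+ (k == n).

Let w_ge0 k : 0 <= w k.
Proof. by rewrite addr_ge0// mulrn_wge0// subr_ge0. Qed.

(** The p-th roots of the weight [w] form a unit vector of l_p, and for conjugate
    exponents the product of two such vectors is [w] up to sign: equality in
    Hoelder's inequality. The bit [b] selects one of two antipodal vectors. *)
Let extremal (p : R) (b : bool) k : R[i] := ((-1) ^+ b * w k `^ p^-1)%:C.

Lemma lnorm_extremal p b : 0 < p -> lnorm p (extremal p b) = 1%E.
Proof.
move=> p_gt0; rewrite /lnorm Lnorm_counting//.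
rewrite (_ : \big[+%E/0%E]_(0 <= k <oo) _ = 1%E) ?poweR1r//.
apply: lim_near_cst => //; exists n.+1 => // N /= n_ltN.
transitivity (\sum_(k < N) w k)%:E; last first.
  by rewrite (big_two_point (fun=> alpha) (fun=> 1 - alpha) n_ltN) addrC subrK.
rewrite big_mkord -sumEFin; apply: eq_bigr => k _.
change ((`|cmod (extremal p b k)| `^ p)%:E = (w k)%:E).
rewrite cmod_real normr_id normrM normrX normrN1 expr1n mul1r.
by rewrite ger0_norm ?powR_ge0// -powRrM mulVf ?gt_eqF// powRr1.
Qed.

Lemma extremal_in_class p b (c : nat -> R) : 0 < p ->
  diag_class p c (diag_op c (extremal p b)).
Proof.
move=> p_gt0; exists (extremal p b) => //; split; last by rewrite lnorm_extremal.
by rewrite /lspace /= lnorm_extremal// ltey.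
Qed.

Lemma extremal_prodE p q b k : p^-1 + q^-1 = 1 ->
  diag_op t (extremal p b) k * diag_op s (extremal q false) k =
  ((-1) ^+ b * (t k * s k * w k))%:C.
Proof.
move=> pq; rewrite /diag_op /extremal -!rmorphM /=; congr _%:C.
have wE : w k `^ p^-1 * w k `^ q^-1 = w k.
  by rewrite -powRD pq ?oner_eq0// powRr1.
by rewrite expr0 -[in RHS]wE; ring.
Qed.

Lemma pairing_extremal p q b : p^-1 + q^-1 = 1 ->
  pairing (diag_op t (extremal p b), diag_op s (extremal q false)) =
  ((-1) ^+ b * (alpha * (t 0%N * s 0%N) + (1 - alpha) * (t n * s n)))%:C.
Proof.
move=> pq; rewrite /pairing; set l := (RHS).
apply: (@lim_near_cst R[i]^o (@norm_hausdorff _ _) nat \oo _ l).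
exists n.+1 => // N /= n_ltN; rewrite seriesEord /=.
under eq_bigr do rewrite extremal_prodE//.
rewrite -rmorph_sum -mulr_sumr /=; congr (_ * _)%:C.
rewrite -(big_two_point (fun k => alpha * (t k * s k))
  (fun k => (1 - alpha) * (t k * s k)) n_ltN).
by apply: eq_bigr => k _; rewrite /w mulrDr !mulrnAr ![_ * (_ * _)]mulrC.
Qed.

(** Among the first [n] coordinates only the one of index 0 carries mass, so the
    noise to be hidden is [alpha * (t 0 * s 0)], whatever [r] is. *)
Lemma zero_info_extremal p q b (r eps : R) :
  p^-1 + q^-1 = 1 -> 0 < r -> 0 <= eps -> 0 < t 0%N * s 0%N ->
  alpha * (t 0%N * s 0%N) <= eps ->
  noisy_info eps r (diag_op t (extremal p b), diag_op s (extremal q false))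
    ((0, 0) : 'rV[R[i]]_n * 'rV[R[i]]_n).
Proof.
move=> pq r_gt0 eps_ge0 ts_gt0 le_eps.
have r_neq0 : r != 0 by rewrite gt_eqF.
have termE (k : 'I_n) : cmod (diag_op t (extremal p b) k * diag_op s (extremal q false) k
    - (0 : 'rV_n) ord0 k * (0 : 'rV_n) ord0 k) `^ r =
    ((alpha * (t 0%N * s 0%N)) `^ r) *+ (k == 0%N :> nat).
  rewrite !mxE mulr0 subr0 extremal_prodE// cmod_real normrM normrX normrN1 expr1n.
  rewrite mul1r /w (ltn_eqF (ltn_ord k)) addr0.
  case: eqP => [->|_]; last by rewrite mulr0 normr0 powR0.
  by rewrite mulr1n [_ * alpha]mulrC ger0_norm// mulr_ge0// ltW.
rewrite /noisy_info /=; under eq_bigr do rewrite termE.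
case: n => [|m]; first by rewrite big_ord0 powR0// invr_eq0.
rewrite big_ord_recl /= mulr1n big1 ?addr0//.
by rewrite -powRrM mulfV// powRr1// mulr_ge0// ltW.
Qed.

Lemma recovery_error_ge_two_point (p q r eps : R) Psi :
  1 < p -> q = p / (p - 1) -> 0 < r -> 0 <= eps -> 0 < t 0%N * s 0%N ->
  alpha * (t 0%N * s 0%N) <= eps ->
  ((alpha * (t 0%N * s 0%N) + (1 - alpha) * (t n * s n))%:E <=
   recovery_error (@pairing R) (diag_class p t `*` diag_class q s)
     (@noisy_info R n eps r) Psi)%E.
Proof.
move=> p_gt1 qE r_gt0 eps_ge0 ts_gt0 le_eps.
have [q_gt0 pq] := conjugate_inv_sum p_gt1 qE.
have p_gt0 : 0 < p by exact: lt_trans p_gt1.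
have info b := zero_info_extremal b pq r_gt0 eps_ge0 ts_gt0 le_eps.
have inW b : (diag_class p t `*` diag_class q s)
    (diag_op t (extremal p b), diag_op s (extremal q false)).
  by split; exact: extremal_in_class.
apply: (recovery_error_ge_antipodal _ (inW false) (inW true)
  (info false) (info true)); rewrite pairing_extremal//.
  by rewrite expr0 mul1r.
by rewrite expr1 mulN1r rmorphN.
Qed.

End LowerBound.

Theorem theorem10 (R : realType) (t s : nat -> R)
  (t_gt0 : forall k, 0 < t k) (s_gt0 : forall k, 0 < s k)
  (t_nonincr : nonincreasing_seq t) (s_nonincr : nonincreasing_seq s)
  (n : nat) (p q r eps : R)
  (p_gt1 : 1 < p) (q_def : q = p / (p - 1))
  (r_gt0 : 0 < r) (r_le1 : r <= 1) (eps_ge0 : 0 <= eps) :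
  let A := @pairing R in
  let W := diag_class p t `*` diag_class q s in
  let J := @noisy_info R n eps r in
  (eps <= t 0%N * s 0%N ->
     optimal_error A W J = recovery_error A W J (@Psi_star R t s n) /\
     recovery_error A W J (@Psi_star R t s n) =
       (t n * s n + eps * (1 - (t n * s n) / (t 0%N * s 0%N)))%:E) /\
  (t 0%N * s 0%N < eps ->
     optimal_error A W J = recovery_error A W J (@Psi_zero R n) /\
     recovery_error A W J (@Psi_zero R n) = (t 0%N * s 0%N)%:E).
Proof.
move=> A W J; have ts_gt0 : 0 < t 0%N * s 0%N by exact: mulr_gt0.
split=> [eps_le|eps_gt]; apply: optimal_errorE => [Psi|].
- pose alpha := eps / (t 0%N * s 0%N).
  have alpha_ge0 : 0 <= alpha by rewrite divr_ge0// ltW.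
  have alpha_le1 : alpha <= 1 by rewrite ler_pdivrMr// mul1r.
  have alphaE : alpha * (t 0%N * s 0%N) = eps by rewrite mulfVK// gt_eqF.
  have <- : alpha * (t 0%N * s 0%N) + (1 - alpha) * (t n * s n) =
      t n * s n + eps * (1 - (t n * s n) / (t 0%N * s 0%N)).
    by rewrite alphaE /alpha mulrBl mulrBr; ring.
  by apply: recovery_error_ge_two_point => //; rewrite alphaE.
- apply: recovery_error_le => -[x y] ab [Wx Wy] Jab.
  exact: Psi_star_error Wx Wy Jab.
- have <- : 1 * (t 0%N * s 0%N) + (1 - 1) * (t n * s n) = t 0%N * s 0%N by ring.
  by apply: recovery_error_ge_two_point => //; rewrite mul1r ltW.
- apply: recovery_error_le => -[x y] ab [Wx Wy] _; rewrite subr0.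
  exact: pairing_le Wx Wy.
Qed.
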